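(* Let $N\ge2$, let $J$ be an $N\times N$ Jacobi matrix with eigenvalues $\lambda_1<\dots<\lambda_N$, let $n\in\{0,\dots,N-1\}$, $\theta\in(0,1)$, $M\in\mathbb{R}$, and let $\tilde J$ be the perturbation of $J$ at place $n$ with parameters $\theta,M$, with eigenvalues $\tilde\lambda_1<\dots<\tilde\lambda_N$. Let $K$ be the real number determined by $M=(\theta^{-2}-1)K$. Then, as an identity of rational functions of $\lambda$, $$G(\lambda,n,n)=\frac{1}{1-\theta^2}\left\{\frac{\theta^2}{\lambda-K}-\frac{1}{\lambda-K}\left(\frac{\prod_{j=1}^N(\lambda-\tilde\lambda_j)}{\prod_{j=1}^N(\lambda-\lambda_j)}\right)\right\}.$$
   Context: An $N\times N$ Jacobi matrix is a real symmetric tridiagonal matrix with diagonal entries $a_0,\dots,a_{N-1}\in\mathbb{R}$ and off-diagonal entries $b_0,\dots,b_{N-2}$ ($b_i$ in positions $(i,i+1)$ and $(i+1,i)$, rows and columns being indexed by $0,\dots,N-1$); throughout, $b_i<0$. Perturbation at place $n$: $\tilde J$ has the same entries as $J$ except that $\tilde a_n=\theta^2(a_n+M)$, $\tilde b_{n-1}=\theta b_{n-1}$, $\tilde b_n=\theta b_n$, where the equality for $\tilde b_{n-1}$ is omitted when $n=0$ and that for $\tilde b_n$ is omitted when $n=N-1$. (In the mass-spring interpretation, $\theta^2=m_n/\tilde m_n$, $M=\gamma/m_n$ and $K=\gamma/(\tilde m_n-m_n)$, where the mass $m_n$ is replaced by $\tilde m_n>m_n$ and $\gamma$ is the elasticity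 parameter of the added spring.) Green's function: $G(z,j,j):=\langle\delta_j,(J-z)^{-1}\delta_j\rangle$, where $\delta_j$ is the $j$-th standard basis vector, $j\in\{0,\dots,N-1\}$, and $\langle\cdot,\cdot\rangle$ is the standard scalar product. *)

(* Defs.v *)
From HB Require Import structures.
From mathcomp Require Import all_boot all_order all_algebra.
From mathcomp Require Import reals.

Set Implicit Arguments.
Unset Strict Implicit.
Unset Printing Implicit Defensive.

Import Order.TTheory GRing.Theory Num.Theory.
Local Open Scope ring_scope.

(* The entries are sequences indexed by nat; only a_0, ..., a_{N-1} and
   b_0, ..., b_{N-2} occur in the matrix. *)
Definition jacobi (R : nzRingType) (N : nat) (a b : nat -> R) : 'M[R]_N :=
  \matrix_(i, j)
    if i == j then a i
    else if i.+1 == j :> nat then b i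
    else if j.+1 == i :> nat then b j
    else 0.

Definition perturbed_diag (R : nzRingType) (n : nat) (theta M : R)
    (a : nat -> R) : nat -> R :=
  fun i => if i == n then theta ^+ 2 * (a n + M) else a i.

(* For n = 0 no index satisfies i.+1 == n, and for n = N - 1 the entry of
   index n does not occur in the N x N matrix, so the two boundary cases need
   no separate treatment. *)
Definition perturbed_offdiag (R : nzRingType) (n : nat) (theta : R)
    (b : nat -> R) : nat -> R :=
  fun i => if (i.+1 == n) || (i == n) then theta * b i else b i.

Definition perturbed_jacobi (R : nzRingType) (N n : nat) (theta M : R)
    (a b : nat -> R) : 'M[R]_N :=
  jacobi N (perturbed_diag n theta M a) (perturbed_offdiag n theta b).

Definition increasing_eigenvalues (R : realFieldType) (N : nat)
    (A : 'M[R]_N) (lam : 'I_N -> R) : Prop :=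
  (forall i j : 'I_N, (i < j)%N -> lam i < lam j) /\
  (forall x : R, eigenvalue A x <-> exists i : 'I_N, x = lam i).

Definition scalar_product (F : nzRingType) (N : nat) (u v : 'cV[F]_N) : F :=
  \sum_i u i 0 * v i 0.

(* The field F is arbitrary, so that z may be either a number or the
   indeterminate of a field of rational functions. When A - z is singular,
   invmx (A - z) is A - z itself and the value is meaningless; this never
   happens if A has constant entries and z is the indeterminate. *)
Definition green (F : fieldType) (N : nat) (A : 'M[F]_N) (z : F)
    (j : 'I_N) : F :=
  scalar_product (delta_mx j 0) (invmx (A - z%:M) *m delta_mx j 0).

Definition ratC (R : fieldType) (c : R) : {fraction {poly R}} :=
  tofrac c%:P.

Definition ratX (R : fieldType) : {fraction {poly R}} :=
  tofrac 'X.

(* Main.v *)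
(* Up to a factor [theta] on row and column [n], [J~ - z] is the rank-one
   perturbation of [J - z] by [- (theta^-2 - 1) (z - K)] at the entry [(n, n)].
   Expanding along row [n], its determinant is
   [theta^2 (det (J - z) - (theta^-2 - 1) (z - K) C)], where [C] is the [(n, n)]
   cofactor of [J - z]; dividing by [det (J - z)] turns [C] into the Green's
   function, and the determinants factor over the eigenvalues. *)

Require Import Defs.
From HB Require Import structures.
From mathcomp Require Import all_boot all_order all_algebra.
From mathcomp Require Import reals.
From mathcomp Require Import ring.

Set Implicit Arguments.
Unset Strict Implicit.
Unset Printing Implicit Defensive.

Import Order.TTheory GRing.Theory Num.Theory.
Local Open Scope ring_scope.

(** Cofactors along row [n] do not see row [n], so the expansion along it is affine in the entry
    [(n, n)]. *)
Lemma det_add_delta_mx (R : comNzRingType) (N : nat) (A : 'M[R]_N)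
    (n : 'I_N) (c : R) :
  \det (A + c *: delta_mx n n) = \det A + c * cofactor A n n.
Proof.
have cofE j : cofactor (A + c *: delta_mx n n) n j = cofactor A n j.
  rewrite /cofactor; congr (_ * \det _).
  by apply/matrixP => i k; rewrite !mxE eq_sym (negPf (neq_lift _ _)) mulr0 addr0.
rewrite (expand_det_row _ n) (expand_det_row A n).
under eq_bigr => j _ do rewrite cofE !mxE eqxx /= mulrDl.
rewrite big_split /=; congr (_ + _).
rewrite (bigD1 n) //= eqxx mulr1 big1 ?addr0 // => j /negPf->.
by rewrite mulr0 mul0r.
Qed.

(** Here [B = D A D] with [D] diagonal and [det D = t]. The entrywise hypothesis can be checked case
    by case on tridiagonal matrices. *)
Lemma det_scale_row_col (R : comNzRingType) (N : nat) (A B : 'M[R]_N)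
    (n : 'I_N) (t : R) :
  (forall i j, B i j = (if i == n then t else 1) * A i j
                       * (if j == n then t else 1)) ->
  \det B = t ^+ 2 * \det A.
Proof.
move=> BE; pose d : 'rV[R]_N := \row_i (if i == n then t else 1).
have -> : B = diag_mx d *m A *m diag_mx d.
  by apply/matrixP => i j; rewrite mul_mx_diag mul_diag_mx !mxE BE.
have detd : \det (diag_mx d) = t.
  rewrite det_diag (bigD1 n) //= mxE eqxx big1 ?mulr1 // => i /negPf ni.
  by rewrite mxE ni.
by rewrite !det_mulmx detd; ring.
Qed.

Lemma greenE (F : fieldType) (N : nat) (A : 'M[F]_N) (z : F) (j : 'I_N) :
  green A z j = invmx (A - z%:M) j j.
Proof.
rewrite /green /scalar_product -colE (bigD1 j) //= !mxE !eqxx mul1r.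
by rewrite big1 ?addr0 // => i /negPf ij; rewrite !mxE ij mul0r.
Qed.

Lemma invmxN (F : fieldType) (N : nat) (A : 'M[F]_N) :
  invmx (- A) = - invmx A.
Proof.
have uN : (- A \in unitmx) = (A \in unitmx).
  by rewrite -scaleN1r unitmxZ ?unitrN1.
(* For singular [A], [invmx] is the identity on both [A] and [- A], so the equality persists. *)
have [uA|uA] := boolP (A \in unitmx); last by rewrite [in RHS]invmx_out ?invmx_out ?inE ?uN.
by rewrite -scaleN1r invmxZ ?scaleN1r ?uN // invrN invr1 scaleN1r.
Qed.

(** Cramer's rule; the sign comes from passing from [A - z], which [green] inverts, to the
    characteristic matrix [z - A]. *)
Lemma green_cofactor (F : fieldType) (N : nat) (A : 'M[F]_N) (z : F)
    (j : 'I_N) :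
  \det (z%:M - A) != 0 ->
  green A z j = - (cofactor (z%:M - A) j j / \det (z%:M - A)).
Proof.
move=> detB; rewrite greenE -opprB invmxN mxE /invmx unitmxE unitfE detB.
by rewrite !mxE mulrC.
Qed.

(** Strict monotonicity makes the [lam i] pairwise distinct: [N] simple roots exhaust a monic
    polynomial of degree [N]. *)
Lemma char_poly_increasing_eigenvalues (R : realFieldType) (N : nat)
    (A : 'M[R]_N) (lam : 'I_N -> R) :
  increasing_eigenvalues A lam ->
  char_poly A = \prod_(j < N) ('X - (lam j)%:P).
Proof.
move=> [lam_lt eigA]; pose s := [seq lam i | i <- index_enum 'I_N].
have lam_inj : injective lam.
  move=> i j eq_ij; apply/val_inj; case: (ltngtP i j) => // /lam_lt;
    by rewrite eq_ij ltxx.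
have us : uniq s by rewrite map_inj_uniq // index_enum_uniq.
have size_s : size s = N by rewrite size_map /index_enum -enumT size_enum_ord.
rewrite (@all_roots_prod_XsubC _ (char_poly A) s).
- by rewrite (monicP (char_poly_monic A)) scale1r big_map.
- by rewrite size_char_poly size_s.
- apply/allP => _ /mapP[i _ ->].
  by rewrite -eigenvalue_root_char; apply/eigA; exists i.
- by rewrite uniq_rootsE.
Qed.

HB.instance Definition _ (R : fieldType) :=
  GRing.RMorphism.copy (@ratC R) (@tofrac {poly R} \o @polyC R).

Lemma tofrac_char_poly (R : fieldType) (N : nat) (A : 'M[R]_N) :
  tofrac (char_poly A) = \det ((ratX R)%:M - map_mx (@ratC R) A).
Proof.
rewrite /char_poly -det_map_mx; congr (\det _).
by apply/matrixP => i j; rewrite !mxE rmorphB rmorphMn.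
Qed.

Lemma det_perturbed_jacobi (F : fieldType) (N : nat) (a b : nat -> F)
    (n : 'I_N) (theta K z : F) : theta != 0 ->
  \det (z%:M - perturbed_jacobi N n theta ((theta ^- 2 - 1) * K) a b) =
  theta ^+ 2 * (\det (z%:M - jacobi N a b) +
    (theta ^- 2 - 1) * (z - K) * cofactor (z%:M - jacobi N a b) n n).
Proof.
(* At [(n, n)] the scaled entry is [theta^2 (z - a_n) + (1 - theta^2) (z - K)], that is
   [z - theta^2 (a_n + M)] with [M = (theta^-2 - 1) K]. *)
move=> theta0; rewrite -det_add_delta_mx; apply: (@det_scale_row_col _ _ _ _ n) => i j.
rewrite !mxE /perturbed_diag /perturbed_offdiag.
have val_eq (k l : 'I_N) : (k == l :> nat) = (k == l) by [].
have [<-{j}|ij] := eqVneq i j.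
  rewrite val_eq; have [->|ni] := eqVneq i n; rewrite /= ?eqxx ?(negPf ni) ?mulr1n; first by field.
  by rewrite mulr0; ring.
(* Off the diagonal at most one index equals [n], so an entry takes at most one factor [theta], as
   in [perturbed_offdiag]. *)
have [in_|in_] := eqVneq i n; have [jn|jn] := eqVneq j n;
  first (by move: ij; rewrite in_ jn eqxx).
all: rewrite /= ?mulr0n ?mulr0 ?addr0 ?sub0r.
all: case: eqP => [ij1|_]; last case: eqP => [ji1|_].
all: rewrite ?ij1 ?ji1 ?val_eq ?in_ ?jn ?eqxx ?orbT ?(negPf in_) ?(negPf jn) //=.
all: by ring.
Qed.

Lemma map_perturbed_jacobi (R F : fieldType) (f : {rmorphism R -> F}) (N n : nat)
    (theta M : R) (a b : nat -> R) :
  map_mx f (perturbed_jacobi N n theta M a b) =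
  perturbed_jacobi N n (f theta) (f M) (f \o a) (f \o b).
Proof.
apply/matrixP => i j; rewrite !mxE /perturbed_diag /perturbed_offdiag /=.
by do !case: ifP => _; rewrite ?(rmorphM, rmorphXn, rmorphD, rmorph0).
Qed.

Lemma map_jacobi (R F : nzRingType) (f : {rmorphism R -> F}) (N : nat)
    (a b : nat -> R) :
  map_mx f (jacobi N a b) = jacobi N (f \o a) (f \o b).
Proof.
by apply/matrixP => i j; rewrite !mxE /=; do !case: ifP => _; rewrite ?rmorph0.
Qed.

Lemma green_det_perturbed_jacobi (R F : fieldType) (f : {rmorphism R -> F})
    (N : nat) (a b : nat -> R) (n : 'I_N) (theta K : R) (z : F) :
  theta != 0 -> theta ^+ 2 != 1 -> z - f K != 0 ->
  \det (z%:M - map_mx f (jacobi N a b)) != 0 ->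
  green (map_mx f (jacobi N a b)) z n =
  1 / (1 - f theta ^+ 2) *
  (f theta ^+ 2 / (z - f K) -
   1 / (z - f K) *
   (\det (z%:M - map_mx f
             (perturbed_jacobi N n theta ((theta ^- 2 - 1) * K) a b)) /
    \det (z%:M - map_mx f (jacobi N a b)))).
Proof.
move=> theta0 theta1 zK; rewrite map_perturbed_jacobi map_jacobi => detJ.
have ftheta0 : f theta != 0 by rewrite fmorph_eq0.
have ftheta1 : 1 - f theta ^+ 2 != 0.
  by rewrite -rmorphXn -(rmorph1 f) -rmorphB fmorph_eq0 subr_eq0 eq_sym.
have -> : f ((theta ^- 2 - 1) * K) = (f theta ^- 2 - 1) * f K.
  by rewrite rmorphM rmorphB rmorph1 fmorphV rmorphXn.
rewrite green_cofactor // det_perturbed_jacobi //.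
(* What remains is a rational identity in the determinant [d] and the cofactor [c]: the terms
   [theta^2 / (z - K)] cancel, leaving [- c / d]. *)
move: (\det _) (cofactor _ _ _) detJ => d c d0.
by field; rewrite d0 zK ftheta0 ftheta1.
Qed.

Theorem theorem1 (R : realType) (N : nat) (hN : (2 <= N)%N)
    (a b : nat -> R) (hb : forall i : nat, (i.+1 < N)%N -> b i < 0)
    (lam : 'I_N -> R) (hlam : increasing_eigenvalues (jacobi N a b) lam)
    (n : 'I_N) (theta M : R) (htheta0 : 0 < theta) (htheta1 : theta < 1)
    (lam' : 'I_N -> R)
    (hlam' : increasing_eigenvalues (perturbed_jacobi N n theta M a b) lam')
    (K : R) (hK : M = (theta ^- 2 - 1) * K) :
  green (map_mx (@ratC R) (jacobi N a b)) (ratX R) n =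
  1 / (1 - ratC theta ^+ 2) *
  (ratC theta ^+ 2 / (ratX R - ratC K) -
   1 / (ratX R - ratC K) *
   ((\prod_(j < N) (ratX R - ratC (lam' j))) /
    (\prod_(j < N) (ratX R - ratC (lam j))))).
Proof.
have prodE (l : 'I_N -> R) :
    \prod_(j < N) (ratX R - ratC (l j)) = tofrac (\prod_(j < N) ('X - (l j)%:P)).
  by rewrite rmorph_prod; apply: eq_bigr => j _; rewrite rmorphB.
rewrite !prodE -(char_poly_increasing_eigenvalues hlam).
rewrite -(char_poly_increasing_eigenvalues hlam') !tofrac_char_poly {}hK.
apply: green_det_perturbed_jacobi.
- by rewrite gt_eqF.
- by rewrite lt_eqF // expr_lt1 // ltW.
(* As [z] is the indeterminate, [z - K] is nonzero even when [K] is an eigenvalue. *)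
- by rewrite -rmorphB tofrac_eq0 polyXsubC_eq0.
- by rewrite -tofrac_char_poly tofrac_eq0 monic_neq0 ?char_poly_monic.
Qed.
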